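(* Let $A$ be an arbitrary ordered normed algebra with unit $\mathbf e$. Then the center $A_{\mathbf e}$ is a closed subset of $A$.
   Context: An ordered normed algebra is a normed algebra $A$ (over $\mathbb R$ or $\mathbb C$, not necessarily complete) with a unit $\mathbf e$ and a (norm-)closed convex cone $A^+$ (closed under sums and multiplication by non-negative reals, $A^+\cap(-A^+)=\{0\}$) such that $\mathbf e\in A^+$ and $ab\in A^+$ whenever $a,b\in A^+$. Write $a\le b$ if $b-a\in A^+$. The center of $A$ is $A_{\mathbf e}=\{a\in A:-\lambda\mathbf e\le a\le\lambda\mathbf e\text{ for some real }\lambda\ge0\}$. *)

(* Defs.v *)
From mathcomp Require Import all_boot all_order all_algebra.
From mathcomp Require Import complex.
From mathcomp Require Import boolp classical_sets reals topology normedtype.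

Set Implicit Arguments.
Unset Strict Implicit.
Unset Printing Implicit Defensive.

Import Order.TTheory GRing.Theory Num.Theory.
Import numFieldNormedType.Exports.

Local Open Scope classical_set_scope.
Local Open Scope ring_scope.

(* The product is a field on top of a normedModType because Hierarchy-Builder
   rejects a join of NormedModule with the ring structures: NumDomain already
   inherits from both sides without an intermediate join.
   As usual for normed algebras, the product is associative and the norm is
   submultiplicative; completeness, commutativity, `|one| = 1 and one != 0 are
   not required.
   When K = R[i], norms take their values in the nonnegative reals of R[i]. *)
Record normedAlgebra (K : numFieldType) := NormedAlgebra {
  nalg_sort :> normedModType K;
  nalg_mul : nalg_sort -> nalg_sort -> nalg_sort;
  nalg_one : nalg_sort;
  nalg_mulA : associative nalg_mul;
  nalg_mul1 : left_id nalg_one nalg_mul;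
  nalg_mulr1 : right_id nalg_one nalg_mul;
  nalg_mulDl : forall a b c, nalg_mul (a + b) c = nalg_mul a c + nalg_mul b c;
  nalg_mulDr : forall a b c, nalg_mul a (b + c) = nalg_mul a b + nalg_mul a c;
  nalg_mulZl : forall (k : K) a b, nalg_mul (k *: a) b = k *: nalg_mul a b;
  nalg_mulZr : forall (k : K) a b, nalg_mul a (k *: b) = k *: nalg_mul a b;
  nalg_normM : forall a b, `|nalg_mul a b| <= `|a| * `|b|
}.

Arguments nalg_mul {K n}.
Arguments nalg_one {K n}.

(* In R[i], z <= w means that w - z is real and nonnegative, so that for
   K = R[i] the scalars r with 0 <= r, here and in `ona_center`, are exactly the
   nonnegative real numbers. *)
Record is_positive_cone (K : numFieldType) (A : normedAlgebra K) (P : set A) :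
    Prop := IsPositiveCone {
  cone_closed : closed P;
  cone_add : forall a b, P a -> P b -> P (a + b);
  cone_scale : forall (r : K) a, 0 <= r -> P a -> P (r *: a);
  cone_pointed : P `&` (-%R @` P) = [set 0];
  cone_one : P nalg_one;
  cone_mul : forall a b, P a -> P b -> P (nalg_mul a b)
}.

Record orderedNormedAlgebra (K : numFieldType) := OrderedNormedAlgebra {
  ona_sort :> normedAlgebra K;
  ona_cone : set ona_sort;
  ona_coneP : is_positive_cone ona_cone
}.

Definition ona_le (K : numFieldType) (A : orderedNormedAlgebra K) (a b : A) :
  Prop := ona_cone (b - a).

Definition ona_center (K : numFieldType) (A : orderedNormedAlgebra K) : set A :=
  [set a | exists2 r : K, 0 <= r &
     ona_le (- (r *: nalg_one)) a /\ ona_le a (r *: nalg_one)].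

Arguments ona_center {K} A.

(* Main.v *)
Require Import Defs.
From mathcomp Require Import all_boot all_order all_algebra.
From mathcomp Require Import complex.
From mathcomp Require Import boolp classical_sets reals topology normedtype.
From mathcomp Require Import ring.

Set Implicit Arguments.
Unset Strict Implicit.
Unset Printing Implicit Defensive.

Import Order.TTheory GRing.Theory Num.Theory.
Import numFieldNormedType.Exports.

Local Open Scope classical_set_scope.
Local Open Scope ring_scope.

(** Write e for the unit and P for the cone.  Everything rests on one fact: an
    element x of the center with `|x| <= 1 satisfies x <= e
    ([center_contraction_le_one]).  Applied to differences of elements of the
    center, and passed to the closure, it shows that a point a of the closure,
    at distance less than 1 from some b in the center, satisfies
    - e <= a - b <= e; hence a - b, and with it a, lies in the center.

    To see that x <= e, note first that squares of elements of the center are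
    positive ([acone_sqr_bounded]).  If u and v are positive and u + v = e, the
    sum of 'C(n, k) (k - s)^2 u^k v^(n-k) over k is a positive element for
    every real s, and by the computation of the variance of a binomial variable
    it equals n u v + (n u - s e)^2.  Replacing s by n s, dividing by n^2 and
    letting n go to infinity shows that (u - s e)^2 is positive, because P is
    closed.  Every element of the center is, up to a positive factor, of the
    form u - s e.

    From (y - e)^2 >= 0, that is, y^2 - e >= 2 (y - e), repeated squaring gives
    the Bernoulli inequality x^(2^k) - e >= 2^k (x - e).  When `|x| <= 1 the
    left-hand side stays bounded in norm, so dividing by 2^k and letting k go to
    infinity yields e - x >= 0.

    Since only one element x is involved at a time, the algebra takes place in
    the commutative ring of polynomials in x: P is pulled back to {poly K} along
    the evaluation at x, where its closedness survives as the archimedean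
    property. *)

(** * Archimedean cones in commutative algebras *)

Record archimedean_cone (K : numFieldType) (C : comAlgType K) (Q : set C) :
    Prop := ArchimedeanCone {
  acone_one : Q 1;
  acone_add : forall a b, Q a -> Q b -> Q (a + b);
  acone_scale : forall (r : K) a, 0 <= r -> Q a -> Q (r *: a);
  acone_mul : forall a b, Q a -> Q b -> Q (a * b);
  acone_arch : forall a b, (forall n, Q (n%:R * a + b)) -> Q a
}.

Section ArchimedeanCone.
Context (K : numFieldType) (C : comAlgType K) (Q : set C).
Hypothesis Qc : archimedean_cone Q.

(** The element F n s = n u (c - u) + (n u - s)^2 satisfies
    c F (n + 1) s = u F n (s - c) + (c - u) F n s, the recurrence obtained by
    conditioning on the last Bernoulli trial; positivity follows by induction
    on n, without writing the binomial sum. *)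
Lemma acone_variance (c s : K) (u : C) (n : nat) :
  0 < c -> s \is Num.real -> Q u -> Q (c%:A - u) ->
  Q (n%:R * (u * (c%:A - u)) + (n%:R * u - s%:A) ^+ 2).
Proof.
move=> c0 + Qu Qv; have rc : c \is Num.real by rewrite realE ltW.
elim: n s => [|n IHn] s rs.
  rewrite !mul0r add0r sub0r sqrrN -in_algE -rmorphXn /=.
  by apply: (acone_scale Qc) (acone_one Qc); rewrite real_exprn_even_ge0.
have Qn := acone_add Qc
  (acone_mul Qc Qu (IHn (s - c) (realB rs rc)))
  (acone_mul Qc Qv (IHn s rs)).
have c1 : 0 <= c^-1 by rewrite invr_ge0 ltW.
have := acone_scale Qc c1 Qn; congr Q.
rewrite -[RHS](scalerK (lt0r_neq0 c0)); congr (_ *: _).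
rewrite -[RHS]mulr_algl -!in_algE; ring.
Qed.

(** The limit of F n (n s) / n^2 for n going to infinity, with F as in
    [acone_variance]: its other term u (c - u) / n vanishes by the archimedean
    property. *)
Lemma acone_sqr_sub (c s : K) (u : C) :
  0 < c -> s \is Num.real -> Q u -> Q (c%:A - u) -> Q ((u - s%:A) ^+ 2).
Proof.
move=> c0 rs Qu Qv; apply: (acone_arch Qc (b := u * (c%:A - u))) => -[|n].
  by rewrite mul0r add0r; apply: (acone_mul Qc).
have rns : n.+1%:R * s \is Num.real by rewrite realM.
have n0 : 0 <= n.+1%:R^-1 :> K by rewrite invr_ge0.
have := acone_scale Qc n0 (acone_variance n.+1 c0 rns Qu Qv).
have nn : n.+1%:R != 0 :> K by rewrite pnatr_eq0.
congr Q; rewrite -[RHS](scalerK nn); congr (_ *: _).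
rewrite -[RHS]mulr_algl -!in_algE; ring.
Qed.

Lemma acone_sqr_bounded (m s : K) (y : C) :
  0 <= m -> s \is Num.real -> Q (m%:A - y) -> Q (m%:A + y) ->
  Q ((y - s%:A) ^+ 2).
Proof.
move=> m0 rs Qv Qu.
have Q1 := acone_one Qc.
(* Take u = y + (m + 1) and c = 2 (m + 1): adding 1 to m makes c nonzero. *)
have rm : s + (m + 1) \is Num.real by rewrite !realD // realE m0.
have c0 : 0 < (m + 1) + (m + 1) by rewrite addr_gt0 // ltr_wpDl.
have := acone_sqr_sub (u := m%:A + y + 1) c0 rm.
have -> : m%:A + y + 1 - (s + (m + 1))%:A = y - s%:A by rewrite -!in_algE; ring.
apply; first exact: (acone_add Qc).
have -> : ((m + 1) + (m + 1))%:A - (m%:A + y + 1) = m%:A - y + 1.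
  by rewrite -!in_algE; ring.
exact: (acone_add Qc).
Qed.

(** Repeated squaring preserves two-sided bounds: r^2 - y^2 = (r - y) (r + y),
    and r^2 + y^2 is positive because squares are. *)
Lemma acone_bounded_exp2 (x : C) (m : K) (k : nat) :
  0 <= m -> Q (m%:A - x) -> Q (m%:A + x) ->
  exists2 r : K, 0 <= r & Q (r%:A - x ^+ (2 ^ k)) /\ Q (r%:A + x ^+ (2 ^ k)).
Proof.
move=> m0 Qv Qu; elim: k => [|k [r r0 [Qrv Qru]]]; first by exists m.
exists (r ^+ 2); first exact: exprn_ge0.
rewrite expnSr exprM; split.
  have -> : (r ^+ 2)%:A - (x ^+ (2 ^ k)) ^+ 2 =
            (r%:A - x ^+ (2 ^ k)) * (r%:A + x ^+ (2 ^ k)).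
    by rewrite -!in_algE; ring.
  exact: (acone_mul Qc).
apply: (acone_add Qc).
  by apply: (acone_scale Qc) (acone_one Qc); apply: exprn_ge0.
have := acone_sqr_bounded r0 (real0 _) Qrv Qru.
by rewrite scale0r subr0.
Qed.

(** The Bernoulli inequality x^N - 1 >= N (x - 1), for N a power of 2 only:
    the step from y = x^(2^k) to y^2 adds (y - 1)^2 to twice the previous
    inequality. *)
Lemma acone_bernoulli (x : C) (m : K) (k : nat) :
  0 <= m -> Q (m%:A - x) -> Q (m%:A + x) ->
  Q ((2 ^ k)%:R * (1 - x) + (x ^+ (2 ^ k) - 1)).
Proof.
move=> m0 Qv Qu; elim: k => [|k IHk].
  have -> : (2 ^ 0)%:R * (1 - x) + (x ^+ (2 ^ 0) - 1) = 0 :> C.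
    by rewrite expn0; ring.
  by rewrite -(scale0r 1); apply: (acone_scale Qc) (acone_one Qc).
have [r r0 [Qrv Qru]] := acone_bounded_exp2 k m0 Qv Qu.
have Qs := acone_sqr_bounded r0 (real1 _) Qrv Qru.
have := acone_add Qc (acone_add Qc IHk IHk) Qs.
congr Q; rewrite scale1r expnSr exprM natrM; ring.
Qed.

End ArchimedeanCone.

(** * Polynomials in an element of a normed algebra *)

Lemma nalg_mulr0 (K : numFieldType) (A : normedAlgebra K) (a : A) : nalg_mul a 0 = 0.
Proof. by rewrite -(scale0r 0) nalg_mulZr !scale0r. Qed.

Lemma nalg_mul0r (K : numFieldType) (A : normedAlgebra K) (a : A) : nalg_mul 0 a = 0.
Proof. by rewrite -(scale0r 0) nalg_mulZl !scale0r. Qed.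

Section Evaluation.
Context (K : numFieldType) (A : normedAlgebra K) (x : A).

Definition nalg_exp (n : nat) : A := iter n (nalg_mul x) nalg_one.

Definition nalg_eval (p : {poly K}) : A :=
  \sum_(i < size p) p`_i *: nalg_exp i.

Lemma nalg_eval_wide n (p : {poly K}) : (size p <= n)%N ->
  nalg_eval p = \sum_(i < n) p`_i *: nalg_exp i.
Proof.
move=> le_p_n; rewrite /nalg_eval.
rewrite (big_ord_widen n (fun i => p`_i *: nalg_exp i)) // big_mkcond.
by apply: eq_bigr => i _; case: ltnP => // le_p_i; rewrite nth_default ?scale0r.
Qed.

Lemma nalg_evalD (p q : {poly K}) : nalg_eval (p + q) = nalg_eval p + nalg_eval q.
Proof.
pose n := maxn (size p) (size q).
rewrite !(nalg_eval_wide (n := n)) ?leq_maxl ?leq_maxr ?size_polyD // -big_split /=.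
by apply: eq_bigr => i _; rewrite coefD scalerDl.
Qed.

Lemma nalg_evalZ k p : nalg_eval (k *: p) = k *: nalg_eval p.
Proof.
rewrite (nalg_eval_wide (n := size p)) ?size_scale_leq // scaler_sumr.
by apply: eq_bigr => i _; rewrite coefZ scalerA.
Qed.

Lemma nalg_evalXn n : nalg_eval 'X^n = nalg_exp n.
Proof.
rewrite /nalg_eval size_polyXn big_ord_recr /= coefXn eqxx scale1r big1 ?add0r //.
by move=> i _; rewrite coefXn ltn_eqF // scale0r.
Qed.

Lemma nalg_eval1 : nalg_eval 1 = nalg_one.
Proof. by have := nalg_evalXn 0; rewrite expr0. Qed.

Lemma nalg_evalX : nalg_eval 'X = x.
Proof. by have := nalg_evalXn 1; rewrite expr1 /nalg_exp /= nalg_mulr1. Qed.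

Lemma nalg_evalN p : nalg_eval (- p) = - nalg_eval p.
Proof. by rewrite -scaleN1r nalg_evalZ scaleN1r. Qed.

Lemma nalg_evalXM p : nalg_eval ('X * p) = nalg_mul x (nalg_eval p).
Proof.
rewrite (nalg_eval_wide (n := (size p).+1)); last first.
  by apply: leq_trans (size_polyMleq _ _) _; rewrite size_polyX.
rewrite big_ord_recl coefXM scale0r add0r.
rewrite /nalg_eval (big_morph (nalg_mul x) (nalg_mulDr x) (nalg_mulr0 x)).
by apply: eq_bigr => i _; rewrite coefXM /= nalg_mulZr.
Qed.

Lemma nalg_evalM p q : nalg_eval (p * q) = nalg_mul (nalg_eval p) (nalg_eval q).
Proof.
elim/poly_ind: p q => [|p c IHp] q.
  by rewrite mul0r -[0 in LHS](scale0r 1) -[0 in RHS](scale0r 1) !nalg_evalZ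
    !scale0r nalg_mul0r.
rewrite mulrDl -mulrA mul_polyC !nalg_evalD nalg_mulDl nalg_evalZ !IHp.
rewrite nalg_evalXM nalg_evalX nalg_mulA; congr (_ + _).
by rewrite -alg_polyC nalg_evalZ nalg_eval1 nalg_mulZl nalg_mul1.
Qed.

Lemma nalg_exp_norm n : `|x| <= 1 -> `|nalg_exp n| <= `|nalg_one : A|.
Proof.
move=> x1; elim: n => [|n IHn] //=.
apply: le_trans (nalg_normM _ _) _.
by rewrite -[leRHS]mul1r ler_pM.
Qed.

End Evaluation.

(** * The unit ball of the center *)

Lemma closure_normP (K : numFieldType) (V : normedModType K) (B : set V) (x : V) :
  closure B x <-> forall e : K, 0 < e -> exists2 c, B c & `|x - c| < e.
Proof.
split=> [cl e e0|H U /nbhs_ballP [e /= e0 He]].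
  by have [c [Bc]] := cl _ (nbhsx_ballx x e e0); rewrite -ball_normE; exists c.
have [c Bc xc] := H e e0; exists c; split=> //.
by apply: He; rewrite -ball_normE.
Qed.

Section Center.
Context (K : numFieldType) (A : orderedNormedAlgebra K).
(* Stated with the partial order of K, so as to cover both R and R[i]. *)
Hypothesis K_archi : forall r : K, 0 <= r -> exists n : nat, r < n%:R.

Let P : set A := @ona_cone K A.
Let coneP : is_positive_cone P := ona_coneP A.

(** P is closed, and a + b / m is positive and tends to a as m tends to infinity
    with b bounded.  It is enough to have this along an unbounded set of m. *)
Lemma cone_bounded_perturbation (a : A) (M : K) :
  (forall n : nat, exists m : nat, exists b : A,
     [/\ (n <= m)%N, `|b| <= M & P (m%:R *: a + b)]) -> P a.
Proof.
move=> H; have Pclosed := cone_closed coneP.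
rewrite closedE in Pclosed; apply: Pclosed => /nbhs_ballP [e /= e0 He].
have M0 : 0 <= M by have [m [b [_ bM _]]] := H 0; apply: le_trans bM.
have [n nM] : exists n : nat, M / e < n%:R by apply: K_archi; rewrite divr_ge0 // ltW.
have [m [b [lenm bM Pm]]] := H n.
have n0 : (0 < n)%N.
  by rewrite -(ltr_nat K); apply: le_lt_trans nM; rewrite divr_ge0 // ltW.
have m0 : 0 < m%:R :> K by rewrite ltr0n (leq_trans n0).
apply: (He (a + m%:R^-1 *: b)); last first.
  rewrite -{1}(scalerK (lt0r_neq0 m0) a) -scalerDr.
  by apply: (cone_scale coneP) => //; rewrite invr_ge0 ltW.
rewrite -ball_normE /= opprD addrA subrr sub0r normrN normrZ.
rewrite gtr0_norm ?invr_gt0 // mulrC ltr_pdivrMr //.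
rewrite (le_lt_trans bM) // mulrC -ltr_pdivrMr // (lt_le_trans nM) //.
by rewrite ler_nat.
Qed.

Lemma eval_archimedean_cone (x : A) :
  archimedean_cone [set p : {poly K} | P (nalg_eval x p)].
Proof.
split=> [|p q Pp Pq|r p r0 Pp|p q Pp Pq|p q H] /=.
- by rewrite nalg_eval1; apply: (cone_one coneP).
- by rewrite nalg_evalD; apply: (cone_add coneP).
- by rewrite nalg_evalZ; apply: (cone_scale coneP).
- by rewrite nalg_evalM; apply: (cone_mul coneP).
apply: (cone_bounded_perturbation (M := `|nalg_eval x q|)) => n.
exists n, (nalg_eval x q); split => //.
by have := H n; rewrite /= nalg_evalD mulr_natl -scaler_nat nalg_evalZ.
Qed.

(** The Bernoulli inequality 2^n (e - x) + (x^(2^n) - e) >= 0, in which the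
    second term is bounded by 2 `|e|. *)
Lemma center_contraction_le_one (x : A) :
  ona_center A x -> `|x| <= 1 -> ona_le x nalg_one.
Proof.
move=> [r r0 []]; rewrite /ona_le opprK => Qu Qv x1.
apply: (cone_bounded_perturbation (M := `|nalg_one : A| + `|nalg_one : A|)) => n.
exists (2 ^ n)%N, (nalg_exp x (2 ^ n) - nalg_one); split.
- exact: ltnW (ltn_expl _ _).
- by apply: le_trans (ler_normB _ _) _; rewrite lerD2r nalg_exp_norm.
have := acone_bernoulli (eval_archimedean_cone x) (x := 'X) n r0.
rewrite /= mulr_natl -scaler_nat !(nalg_evalD, nalg_evalN, nalg_evalZ).
rewrite nalg_evalXn nalg_evalX nalg_eval1; apply => //.
by rewrite addrC.
Qed.

Lemma centerN (x : A) : ona_center A x -> ona_center A (- x).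
Proof.
move=> [r r0 []]; rewrite /ona_le opprK => Qu Qv.
by exists r => //; rewrite /ona_le !opprK; split; rewrite addrC // addrC.
Qed.

Lemma centerB (x y : A) :
  ona_center A x -> ona_center A y -> ona_center A (x - y).
Proof.
move=> [r r0 [Pr1 Pr2]] /centerN [s s0 [Ps1 Ps2]].
exists (r + s); first exact: addr_ge0.
move: Pr1 Pr2 Ps1 Ps2; rewrite /ona_le !opprK => Pr1 Pr2 Ps1 Ps2.
rewrite scalerDl opprB; split.
  by rewrite addrACA; apply: (cone_add coneP).
by rewrite [y - x]addrC addrACA; apply: (cone_add coneP).
Qed.

(** The open condition `|x| < 1 passes to nearby elements of the center, and
    the positivity of e - x is a closed condition. *)
Lemma closure_center_le_one (x : A) :
  closure (ona_center A) x -> `|x| < 1 -> ona_le x nalg_one.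
Proof.
move=> clx x1; apply: (cone_closed coneP); apply/closure_normP => e e0.
have d0 : 0 < 1 - `|x| by rewrite subr_gt0.
have [c [Cc [xe xd]]] := clx _ (filterI (nbhsx_ballx x e e0) (nbhsx_ballx x _ d0)).
move: xe xd; rewrite -!ball_normE /= => xe xd.
exists (nalg_one - c); last first.
  by rewrite opprB addrC addrA subrK distrC.
apply: center_contraction_le_one => //.
rewrite -[c](subKr x) (le_trans (ler_normB _ _)) //.
by rewrite -lerBrDl ltW.
Qed.

Lemma center_closed : closed (ona_center A).
Proof.
move=> a cl_a.
have [b Cb ab] := (closure_normP _ _).1 cl_a 1 ltr01.
have cl_ab : closure (ona_center A) (a - b).
  apply/closure_normP => e e0; have [c Cc ac] := (closure_normP _ _).1 cl_a e e0.
  exists (c - b); first exact: centerB.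
  by rewrite opprB addrA subrK.
have cl_ba : closure (ona_center A) (- (a - b)).
  apply/closure_normP => e e0; have [c Cc ac] := (closure_normP _ _).1 cl_ab e e0.
  exists (- c); first exact: centerN.
  by rewrite -opprD normrN.
have ab_le := closure_center_le_one cl_ab ab.
have ba_le : ona_le (- (a - b)) nalg_one.
  by apply: closure_center_le_one => //; rewrite normrN.
rewrite -[a](subrK b) -[X in _ + X]opprK; apply: centerB; last exact: centerN.
exists 1 => //; rewrite scale1r; split=> //.
by move: ba_le; rewrite /ona_le !opprK addrC.
Qed.

End Center.

Lemma complex_archi (R : realType) (r : R[i]) :
  0 <= r -> exists n : nat, r < n%:R.
Proof.
move=> r0; have Rr : r = (complex.Re r)%:C%C by rewrite RRe_real // ger0_real.
move: r0; rewrite Rr lecR => r0.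
exists (Num.bound (complex.Re r)).
by rewrite -(rmorph_nat (real_complex R)) ltcR archi_boundP.
Qed.

Theorem theorem38 (R : realType) :
  (forall A : orderedNormedAlgebra R, closed (ona_center A)) /\
  (forall A : orderedNormedAlgebra R[i], closed (ona_center A)).
Proof.
split=> A; apply: center_closed; last exact: complex_archi.
by move=> r r0; exists (Num.bound r); apply: archi_boundP.
Qed.
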